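(* Let $q$ be a prime power. Then $|IST_{1}(\mathbb{F}_q)|=q-1$, $|IST_{2}(\mathbb{F}_q)|=q^2(q-1)$, and $$|IST_n(\mathbb{F}_q)|=q(q-1)\,|IST_{n-1}(\mathbb{F}_q)|+q^2(q-1)\,|IST_{n-2}(\mathbb{F}_q)|$$ for all $n\ge 3$.
   Context: $\mathbb{F}_q$ is the finite field with $q$ elements. For $n\ge 1$, $ST_n(\mathbb{F}_q)$ is the set of $n\times n$ symmetric tridiagonal matrices over $\mathbb{F}_q$, i.e. symmetric matrices whose entries outside the main diagonal, the subdiagonal and the superdiagonal are zero (arbitrary $1\times 1$ matrices when $n=1$). $IST_n(\mathbb{F}_q)=\{A\in ST_n(\mathbb{F}_q): \det(A)\neq 0\}$. *)

(* Defs.v *)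
From mathcomp Require Import all_boot all_algebra.
Set Implicit Arguments.
Unset Strict Implicit.
Unset Printing Implicit Defensive.
Import GRing.Theory.
Local Open Scope ring_scope.

Definition is_tridiag_mx (R : nzRingType) (n : nat) (A : 'M[R]_n) : bool :=
  [forall i : 'I_n, forall j : 'I_n, ((i.+1 < j) || (j.+1 < i))%N ==> (A i j == 0)].

Definition ST (F : finFieldType) (n : nat) : {set 'M[F]_n} :=
  [set A : 'M[F]_n | (A \is symmetricmx) && is_tridiag_mx A].

Definition IST (F : finFieldType) (n : nat) : {set 'M[F]_n} :=
  [set A in ST F n | \det A != 0].

Lemma symmetricmxE (F : finFieldType) (n : nat) (A : 'M[F]_n) :
  (A \is symmetricmx) = (A^T == A).
Proof. by rewrite qualifE /= expr0 scale1r map_mx_id // eq_sym. Qed.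

(* Main.v *)
(* Peel off the first row and column: a matrix in ST_(m+2) consists of a corner
   entry a, an off-diagonal entry b and a trailing block A in ST_(m+1), and its
   determinant is a det A - b^2 det A', where A' is A without its first row and
   column.  If a <> 0 this is a det (A - (b^2 / a) E_00), and translating by a
   multiple of E_00 permutes ST_(m+1): this gives q (q - 1) |IST_(m+1)|.  If
   a = 0, then b <> 0 and A' is invertible, while the first row of A is otherwise
   arbitrary. *)
Require Import Defs.
From mathcomp Require Import all_boot all_algebra.
Set Implicit Arguments.
Unset Strict Implicit.
Unset Printing Implicit Defensive.
Import GRing.Theory.
Local Open Scope ring_scope.

Definition trail_mx (R : Type) (m : nat) (A : 'M[R]_m.+1) : 'M[R]_m :=
  row' 0 (col' 0 A).

Section Border.

Variables (R : comNzRingType) (m : nat).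
Implicit Types (a b c : R) (A : 'M[R]_m.+1).

(** Splitting indices with [unlift 0] makes the trailing block sit at indices [lift 0 _], as in the
    minors of a cofactor expansion. *)
Definition border a b A : 'M[R]_m.+2 :=
  \matrix_(i, j) match unlift 0 i, unlift 0 j with
                 | None, None => a
                 | Some i', Some j' => A i' j'
                 | Some k, None | None, Some k => if k == 0 then b else 0
                 end.

Lemma border00 a b A : border a b A 0 0 = a.
Proof. by rewrite mxE unlift_none. Qed.

Lemma border0S a b A j :
  border a b A 0 (lift 0 j) = if j == 0 then b else 0.
Proof. by rewrite mxE unlift_none liftK. Qed.

Lemma borderS0 a b A i :
  border a b A (lift 0 i) 0 = if i == 0 then b else 0.
Proof. by rewrite mxE unlift_none liftK. Qed.

Lemma borderSS a b A i j : border a b A (lift 0 i) (lift 0 j) = A i j.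
Proof. by rewrite mxE !liftK. Qed.

Lemma trail_border a b A : trail_mx (border a b A) = A.
Proof. by apply/matrixP => i j; rewrite 2!mxE borderSS. Qed.

Lemma det_border a b A :
  \det (border a b A) = a * \det A - b ^+ 2 * \det (trail_mx A).
Proof.
rewrite (expand_det_col _ 0) !big_ord_recl big1 => [|i _]; last first.
  by rewrite borderS0 mul0r.
rewrite addr0 border00 borderS0 eqxx /cofactor -/(trail_mx _) trail_border.
rewrite expr0 mul1r /bump /= expr1 mulN1r mulrN.
congr (_ - _); rewrite expr2 -mulrA; congr (_ * _).
(* The minor left beside the second [b] still has the old row 0, now [b, 0, ..., 0], so a row
   expansion yields the other factor [b]. *)
have lift10 : lift (lift 0 0) 0 = 0 :> 'I_m.+2 by apply: val_inj.
rewrite (expand_det_row _ 0) big_ord_recl big1 => [|i _]; last first.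
  by rewrite !mxE lift10 unlift_none liftK mul0r.
rewrite addr0 /cofactor expr0 mul1r !mxE lift10 unlift_none liftK eqxx.
congr (_ * \det _).
apply/matrixP => i j; rewrite 2!mxE [RHS]mxE [RHS]mxE 2!mxE.
have -> : lift (lift 0 0) (lift 0 i) = lift 0 (lift 0 i) :> 'I_m.+2.
  by apply: val_inj.
by rewrite -[RHS](borderSS a b) ?mxE.
Qed.

(** The perturbation touches row 0 only, so the cofactors along that row are unchanged and the
    determinant is affine in the corner entry. *)
Lemma det_add_corner c A :
  \det (A + c *: delta_mx 0 0) = \det A + c * \det (trail_mx A).
Proof.
rewrite [LHS](expand_det_row _ 0) [\det A](expand_det_row _ 0).
have cofE j : cofactor (A + c *: delta_mx 0 0) 0 j = cofactor A 0 j.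
  rewrite /cofactor; congr (_ * \det _); apply/matrixP => i k.
  by rewrite !mxE /= mulr0 addr0.
under eq_bigr do rewrite cofE 3!mxE mulrDl.
rewrite big_split /=; congr (_ + _).
rewrite big_ord_recl big1 => [|j _]; last by rewrite mulr0 mul0r.
by rewrite addr0 mulr1 /cofactor expr0 mul1r.
Qed.

End Border.

Section Counting.

Variable F : finFieldType.
Implicit Types (a b c : F) (m : nat).

Lemma STP n (A : 'M[F]_n) :
  reflect ((forall i j, A i j = A j i) /\
           (forall i j : 'I_n, (i.+1 < j)%N -> A i j = 0))
          (A \in ST F n).
Proof.
rewrite inE symmetricmxE; apply: (iffP andP) => [[/eqP symA triA]|[symA triA]].
  split=> [i j|i j lt_ij]; first by rewrite -[in LHS]symA mxE.
  by have /forallP/(_ i)/forallP/(_ j) := triA; rewrite lt_ij => /eqP.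
split; first by apply/eqP/matrixP => i j; rewrite mxE.
apply/forallP => i; apply/forallP => j; apply/implyP.
by case/orP=> [/triA ->|/triA]; rewrite // symA => ->.
Qed.

Lemma border_ST m a b (A : 'M[F]_m.+1) :
  (border a b A \in ST F m.+2) = (A \in ST F m.+1).
Proof.
apply/STP/STP => [[symB triB]|[symA triA]].
  split=> [i j|i j lt_ij].
    by have := symB (lift 0 i) (lift 0 j); rewrite !borderSS.
  by rewrite -(borderSS a b) triB.
split=> i j.
  by case: (unliftP 0 i) (unliftP 0 j) => [i'|] -> [j'|] ->;
    rewrite ?borderSS ?borderS0 ?border0S.
case: (unliftP 0 i) (unliftP 0 j) => [i'|] -> [j'|] -> //.
  by rewrite borderSS => /triA.
(* The entry [b] lies in column 1, which [1 < 1] excludes. *)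
by rewrite border0S; case: eqP => // ->.
Qed.

Lemma ST_borderE m (A : 'M[F]_m.+2) :
  A \in ST F m.+2 -> A = border (A 0 0) (A 0 (lift 0 0)) (trail_mx A).
Proof.
case/STP=> symA triA.
have row0 j : A 0 (lift 0 j) = if j == 0 then A 0 (lift 0 0) else 0.
  case: eqP => [->//|/eqP j_neq0]; apply: triA.
  by rewrite /= /bump /= add1n ltnS lt0n.
apply/matrixP => i j.
case: (unliftP 0 i) (unliftP 0 j) => [i'|] -> [j'|] ->.
- by rewrite borderSS !mxE.
- by rewrite borderS0 symA.
- by rewrite border0S.
- by rewrite border00.
Qed.

(** Fibre over the pair of first entries of row 0: [border a b] is injective, with left inverse
    [trail_mx], and its image of the trailing blocks is the fibre over [(a, b)]. *)
Lemma card_ST_border m (P : pred 'M[F]_m.+2) :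
  #|[set A in ST F m.+2 | P A]|
    = (\sum_a \sum_b #|[set B in ST F m.+1 | P (border a b B)]|)%N.
Proof.
rewrite pair_bigA /= -sum1_card.
pose corner (A : 'M[F]_m.+2) := (A 0 0, A 0 (lift 0 0)).
rewrite (partition_big corner predT) //=.
apply: eq_bigr => -[a b] _ /=; rewrite sum1dep_card.
rewrite -[RHS](@card_imset _ _ (border a b)); last first.
  exact: can_inj (@trail_border _ _ a b).
apply: eq_card => A; rewrite inE; apply/andP/imsetP.
  rewrite inE => -[/andP[STA PA] /eqP[<- <-]].
  exists (trail_mx A); last exact: ST_borderE.
  by rewrite inE -(border_ST (A 0 0) (A 0 (lift 0 0))) -ST_borderE // STA.
case=> B; rewrite inE => /andP[STB PB] ->.
by rewrite inE border_ST STB PB /corner border00 border0S.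
Qed.

Lemma add_corner_ST m c (A : 'M[F]_m.+1) :
  A \in ST F m.+1 -> A + c *: delta_mx 0 0 \in ST F m.+1.
Proof.
case/STP=> symA triA; apply/STP; split=> [i j|i j lt_ij].
  by rewrite !mxE symA andbC.
rewrite !mxE triA //; case: (j =P 0) lt_ij => [-> //|_ _].
by rewrite andbF mulr0 addr0.
Qed.

Lemma card_ST_corner m c :
  #|[set A in ST F m.+1 | \det (A + c *: delta_mx 0 0) != 0]| = #|IST F m.+1|.
Proof.
rewrite -(card_imset _ (addIr (c *: delta_mx 0 0))).
apply: eq_card => A; apply/imsetP/idP => [[B]|].
  by rewrite inE => /andP[STB dB] ->; rewrite inE dB add_corner_ST.
rewrite inE => /andP[STA dA].
exists (A - c *: delta_mx 0 0); last by rewrite subrK.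
by rewrite inE subrK dA -scaleNr add_corner_ST.
Qed.

Lemma card_IST_border m a b :
  #|[set A in ST F m.+1 | \det (border a b A) != 0]|
    = if a != 0 then #|IST F m.+1|
      else if b != 0 then #|[set A in ST F m.+1 | \det (trail_mx A) != 0]|
      else 0%N.
Proof.
have [->|a_neq0] := eqVneq a 0 => /=; last first.
  (* With this shift, [a] times the perturbed determinant is the bordered one, so both vanish
     together. *)
  rewrite -(card_ST_corner m (- (a^-1 * b ^+ 2))); apply: eq_card => A.
  rewrite !inE; congr (_ && _); rewrite det_border det_add_corner.
  rewrite -[in RHS](mulrI_eq0 _ (mulfI a_neq0)) mulrDr mulNr mulrN.
  by rewrite mulrA mulVKf.
have [->|b_neq0] := eqVneq b 0 => /=.
  apply: eq_card0 => A; rewrite !inE det_border.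
  by rewrite mul0r expr0n mul0r subrr eqxx andbF.
apply: eq_card => A; rewrite !inE det_border mul0r sub0r oppr_eq0 mulf_eq0.
by rewrite expf_eq0 (negbTE b_neq0).
Qed.

Lemma card_neq0 : #|[pred x : F | x != 0]| = (#|F| - 1)%N.
Proof. by rewrite subn1 -(cardC1 (0 : F)). Qed.

(** The trailing count is left unevaluated so that [m = 0], where the trailing block is empty, is
    covered too. *)
Lemma card_IST_rec m :
  #|IST F m.+2| =
    (#|F| * (#|F| - 1) * #|IST F m.+1|
     + (#|F| - 1) * #|[set A in ST F m.+1 | \det (trail_mx A) != 0%R]|)%N.
Proof.
rewrite card_ST_border (bigD1 0) //= addnC; congr (_ + _)%N.
  under eq_bigr => a a_neq0.
    under eq_bigr => b _ do rewrite card_IST_border a_neq0.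
    rewrite sum_nat_const; over.
  by rewrite sum_nat_const card_neq0 mulnCA mulnA.
(* For [a = 0] only the [q - 1] nonzero values of [b] contribute. *)
under eq_bigr do rewrite card_IST_border eqxx /=.
by rewrite -big_mkcond /= sum_nat_const card_neq0.
Qed.

(** The condition constrains the trailing block alone, leaving [q] free choices for each of the two
    border entries. *)
Lemma card_trail_unit m :
  #|[set A in ST F m.+2 | \det (trail_mx A) != 0]|
    = (#|F| ^ 2 * #|IST F m.+1|)%N.
Proof.
rewrite card_ST_border.
under eq_bigr do under eq_bigr do under eq_finset do rewrite trail_border.
by rewrite !sum_nat_const mulnA mulnn.
Qed.

Lemma ST1 : ST F 1 = setT.
Proof.
by apply/setP => A; rewrite [RHS]inE; apply/STP; split=> i j; rewrite !ord1.
Qed.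

(** A general [P] serves both base cases: nonzero entries for [n = 1], all entries for the trailing
    count in [n = 2]. *)
Lemma card_ST1 (P : pred F) :
  #|[set A in ST F 1 | P (A 0 0)]| = #|P|.
Proof.
have inj : injective (fun x : F => x%:M : 'M[F]_1).
  by move=> x y /matrixP/(_ 0 0); rewrite !mxE.
rewrite -[RHS](card_imset _ inj); apply: eq_card => A.
rewrite ST1 !inE; apply/idP/imsetP => [PA|[x Px ->]].
  by exists (A 0 0); last exact: mx11_scalar.
by rewrite mxE.
Qed.

End Counting.

Local Close Scope ring_scope.

Theorem theorem2p1 (q : nat) (F : finFieldType) (hq : #|F| = q) :
  [/\ #|IST F 1| = q - 1,
      #|IST F 2| = q ^ 2 * (q - 1)
    & forall n : nat, 3 <= n ->
        #|IST F n| = q * (q - 1) * #|IST F (n - 1)|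
                     + q ^ 2 * (q - 1) * #|IST F (n - 2)| ].
Proof.
have IST1 : #|IST F 1| = q - 1.
  rewrite -hq -card_neq0 -card_ST1; apply: eq_card => A.
  by rewrite !inE det_mx11.
split=> //.
  rewrite card_IST_rec hq IST1.
  (* The empty determinant is 1, so every 1 by 1 matrix qualifies. *)
  have -> : #|[set A in ST F 1 | (\det (trail_mx A) != 0)%R]| = q.
    rewrite -hq -(card_ST1 predT); apply: eq_card => A.
    by rewrite !inE det_mx00 oner_neq0.
  (* Positivity makes the truncated [q - 1] satisfy [(q - 1).+1 = q], which merges the two terms. *)
  have q_gt0 : 0 < q by rewrite -hq; apply/card_gt0P; exists 0%R.
  by rewrite [(q - 1) * q]mulnC addnC -mulnS subn1 prednK // mulnAC mulnn.
case=> [|[|[|m]]] // _; rewrite card_IST_rec card_trail_unit hq.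
by rewrite [X in _ + X = _]mulnCA mulnA.
Qed.
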